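(* Let $(V,g)$ be an inner product vector space over $k$, with $k=\mathbb{R}$ or $k=\mathbb{C}$ (possibly infinite-dimensional), and let $\varphi\in\operatorname{End}_k(V)$ be a finite potent endomorphism admissible for the Moore-Penrose inverse. If a core inverse $\varphi^{(\#)}$ of $\varphi$ exists, then $i(\varphi)\leq 1$.
   Context: An endomorphism $\varphi$ of $V$ is finite potent if $\varphi^n(V)$ is finite-dimensional for some $n$. Equivalently, there is a (unique) $\varphi$-invariant decomposition $V=W_\varphi\oplus U_\varphi$ (AST-decomposition) with $\varphi|_{U_\varphi}$ nilpotent, $W_\varphi$ finite-dimensional and $\varphi|_{W_\varphi}$ an automorphism of $W_\varphi$. The index $i(\varphi)$ is the nilpotency order of $\varphi|_{U_\varphi}$ (with $i(\varphi)=0$ iff $V$ is finite-dimensional and $\varphi$ is an automorphism). $\varphi$ is admissible for the Moore-Penrose inverse if $V=\operatorname{Ker}(\varphi)\oplus[\operatorname{Ker}(\varphi)]^{\perp}$ and $V=\operatorname{Im}(\varphi)\oplus[\operatorname{Im}(\varphi)]^{\perp}$. For such a $\varphi$, a linear map $\varphi^{(\#)}\in\operatorname{End}_k(V)$ is a core inverse of $\varphi$ when $\varphi\circ\varphi^{(\#)}=P_{\operatorname{Im}(\varphi)}$ and $\operatorname{Im}(\varphi^{(\#)})\subseteq\operatorname{Im}(\varphi)$, where $P_{\operatorname{Im}(\varphi)}$ is the orthogonal projection onto $\operatorname{Im}(\varphi)$ induced by $V=\operatorname{Im}(\varphi)\oplus[\operatorname{Im}(\varphi)]^{\perp}$. 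*)

(* Defs.v *)
From HB Require Import structures.
From mathcomp Require Import all_boot all_order all_algebra.
From mathcomp Require Import sesquilinear complex.
From mathcomp Require Import boolp classical_sets functions reals.

Set Implicit Arguments.
Unset Strict Implicit.
Unset Printing Implicit Defensive.

Import Order.TTheory GRing.Theory Num.Theory.

Local Open Scope classical_set_scope.
Local Open Scope ring_scope.

Variant base_field := BaseReal | BaseComplex.

Definition scalars (R : realType) (k : base_field) : numFieldType :=
  match k with BaseReal => R | BaseComplex => R[i] end.

(* The identity on the reals, complex conjugation on the complex numbers; an
   inner product over [scalars R k] is a [{dot V for conj_of R k}], which is
   linear in its first argument and conjugate-linear in its second. *)
Definition conj_of (R : realType) (k : base_field) :
    {rmorphism scalars R k -> scalars R k} :=
  match k with
  | BaseReal => (idfun : {rmorphism R -> R})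
  | BaseComplex => (@conjc R : {rmorphism R[i] -> R[i]})
  end.

Section FinitePotent.
Context {K : fieldType} {V : lmodType K}.
Implicit Types (A B W U : set V) (phi : {linear V -> V}).

Definition finite_dim A :=
  exists n (e : 'I_n -> V), A = range (fun c : 'I_n -> K => \sum_i c i *: e i).

Definition direct_sum A B :=
  (forall v, exists a b, [/\ A a, B b & v = a + b]) /\ A `&` B = [set 0].

Definition ker phi : set V := [set v | phi v = 0].

Definition finite_potent phi := exists n, finite_dim (range (iter n phi)).

Definition vanishes_on phi U n := forall u, U u -> iter n phi u = 0.

Record ast_decomposition phi W U : Prop := AST {
  ast_submodW : submod_closed (mem W);
  ast_submodU : submod_closed (mem U);
  ast_sum : direct_sum W U;
  ast_stableW : phi @` W `<=` W;
  ast_stableU : phi @` U `<=` U;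
  ast_nilU : exists n, vanishes_on phi U n;
  ast_fdimW : finite_dim W;
  ast_autW : set_bij W W phi }.

(* The order is 0 exactly when [U] is zero, since [iter 0 phi] is the identity. *)
Definition nilpotency_order phi U n :=
  vanishes_on phi U n /\ (forall m, vanishes_on phi U m -> (n <= m)%N).

Definition is_index phi n :=
  exists W U, ast_decomposition phi W U /\ nilpotency_order phi U n.

(* Meaningful for finite potent [phi], where the default value 0 of [xget] is
   not used: see [fp_indexP]. *)
Definition fp_index phi : nat := xget 0%N (is_index phi).

Lemma iter_is_linear n phi (a : K) (u v : V) :
  iter n phi (a *: u + v) = a *: iter n phi u + iter n phi v.
Proof. by elim: n => //= n ->; rewrite linearP. Qed.

Lemma iter_linear0 n phi : iter n phi 0 = 0.
Proof. by elim: n => //= n ->; rewrite linear0. Qed.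

Lemma iter_linearD n phi u v : iter n phi (u + v) = iter n phi u + iter n phi v.
Proof. by rewrite -[u]scale1r iter_is_linear !scale1r. Qed.

Lemma iter_linearZ n phi a u : iter n phi (a *: u) = a *: iter n phi u.
Proof. by rewrite -[a *: u]addr0 iter_is_linear iter_linear0 addr0. Qed.

Lemma iter_linearB n phi u v : iter n phi (u - v) = iter n phi u - iter n phi v.
Proof. by rewrite -scaleN1r iter_linearD iter_linearZ scaleN1r. Qed.

Lemma iter_linear_sum n phi (I : finType) (F : I -> V) :
  iter n phi (\sum_i F i) = \sum_i iter n phi (F i).
Proof.
apply: (big_morph (iter n phi)); first exact: iter_linearD.
exact: iter_linear0.
Qed.

Lemma ast_nilpart phi W U : ast_decomposition phi W U ->
  U = [set v | exists n, iter n phi v = 0].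
Proof.
move=> [sW sU [dec disj] stW stU [N nilU] _ [_ injW _]].
have itW n x : W x -> W (iter n phi x).
  by move=> Wx; elim: n => //= n IH; apply: stW; exists (iter n phi x).
have itU n x : U x -> U (iter n phi x).
  by move=> Ux; elim: n => //= n IH; apply: stU; exists (iter n phi x).
have W0 : W 0 by case: sW => /set_mem.
have W0inj n x : W x -> iter n phi x = 0 -> x = 0.
  elim: n => //= n IH Wx e; apply: IH => //.
  by apply: injW; rewrite ?inE ?linear0 //; exact: itW.
apply/seteqP; split=> [v Uv|v [n nv]] /=; first by exists N; exact: nilU.
have [a [b [Wa Ub vab]]] := dec v.
have a0 : a = 0.
  apply: (W0inj n) => //.
  suff: (W `&` U) (iter n phi a) by rewrite disj.
  split; first exact: itW.
  have -> : iter n phi a = (-1) *: iter n phi b + 0.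
    by apply/eqP; rewrite addr0 scaleN1r -addr_eq0 -iter_linearD -vab nv.
  have [U0 Ulin] := sU.
  by apply/set_mem; apply: Ulin => //; apply/mem_set; exact: itU.
by rewrite vab a0 add0r.
Qed.

Lemma is_index_unique phi m n : is_index phi m -> is_index phi n -> m = n.
Proof.
move=> [W [U [d [vm lm]]]] [W' [U' [d' [vn ln]]]].
move: (ast_nilpart d') vn ln; rewrite -(ast_nilpart d) => -> vn ln.
by apply/eqP; rewrite eqn_leq lm // ln.
Qed.

(* Cayley-Hamilton on the finite-dimensional stable space [range (iter n phi)]
   yields the relation below. *)
Lemma finite_potent_relation phi : finite_potent phi ->
  exists (m n : nat) (d : nat) (b : 'I_d -> K),
    [/\ (n <= m)%N, finite_dim (range (iter n phi)) &
      forall v, iter m phi v = iter m.+1 phi (\sum_i b i *: iter i phi v)].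
Proof.
move=> [n [d [e im_n]]].
set E := fun c : 'I_d -> K => \sum_i c i *: e i in im_n.
have stab j : exists c, phi (e j) = E c.
  have: range (iter n phi) (e j).
    rewrite im_n; exists (fun i => (i == j)%:R) => //.
    rewrite /E (bigD1 j) //= eqxx scale1r big1 ?addr0 // => i /negPf ->.
    by rewrite scale0r.
  case=> w _ <-.
  have: range (iter n phi) (phi (iter n phi w)).
    by exists (phi w) => //; rewrite -iterSr.
  by rewrite im_n => -[c _ <-]; exists c.
have {stab} [f phie] := choice stab.
case: d e @E im_n f phie => [|d] e E im_n f phie.
  have phi0 v : iter n phi v = 0.
    have: range (iter n phi) (iter n phi v) by exists v.
    by rewrite im_n => -[c _ <-]; rewrite /E big_ord0.
  exists n, n, 0%N, (fun=> 0); split=> [//||v]; first by exists 0%N, e.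
  by rewrite iterS !phi0 linear0.
pose M : 'M[K]_d.+1 := \matrix_(i, j) f i j.
have phiE i (c : 'rV[K]_d.+1) :
    iter i phi (E (fun j => c 0 j)) = E (fun j => (c *m (M ^+ i)) 0 j).
  elim: i => [|i IH] /=; first by rewrite expr0 mulmx1.
  rewrite IH exprSr mulmxA; set c' := c *m _.
  rewrite /E linear_sum /=; under eq_bigr do rewrite linearZ /= phie /E scaler_sumr.
  rewrite exchange_big; apply: eq_bigr => j _ /=.
  rewrite mxE scaler_suml; apply: eq_bigr => l _.
  by rewrite scalerA [M l j]mxE.
pose p := char_poly M.
have hornerM : \sum_(i < size p) p`_i *: M ^+ i = 0.
  have hornerE' (q : {poly K}) : horner_mx M q = \sum_(i < size q) q`_i *: M ^+ i.
    rewrite -{1}(coefK q) poly_def linear_sum /=.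
    by apply: eq_bigr => i _; rewrite linearZ /= rmorphXn /= horner_mx_X.
  by rewrite -hornerE' Cayley_Hamilton.
have rel v : \sum_(i < size p) p`_i *: iter (i + n) phi v = 0.
  have: range (iter n phi) (iter n phi v) by exists v.
  rewrite im_n => -[c _ Ec].
  under eq_bigr do rewrite iterD -Ec.
  have -> : E c = E (fun j => (\row_j c j) 0 j).
    by apply: eq_bigr => j _; rewrite mxE.
  under eq_bigr do rewrite phiE /E scaler_sumr.
  rewrite exchange_big big1 // => j _ /=.
  under eq_bigr do rewrite scalerA.
  rewrite -scaler_suml.
  suff -> : \sum_(i < size p) p`_i * ((\row_j c j) *m M ^+ i) 0 j = 0.
    by rewrite scale0r.
  transitivity (((\row_j c j) *m \sum_(i < size p) p`_i *: M ^+ i) 0 j).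
    by rewrite mulmx_sumr summxE; apply: eq_bigr => i _; rewrite -scalemxAr [RHS]mxE.
  by rewrite hornerM mulmx0 mxE.
have p0 : p != 0 by rewrite monic_neq0 // char_poly_monic.
have exk : exists k, p`_k != 0.
  by exists (size p).-1; rewrite -[p`_ _]/(lead_coef p) lead_coef_eq0.
pose k := ex_minn exk.
have [pk mink] : p`_k != 0 /\ forall i, (i < k)%N -> p`_i = 0.
  rewrite /k; case: ex_minnP => l pl minl; split=> // i il.
  by apply/eqP; apply: contraTT il => /minl; rewrite -leqNgt.
have ks : (k < size p)%N.
  by rewrite ltnNge; apply: contra pk => /leq_sizeP ->.
pose b (i : 'I_(size p)) := - (p`_k)^-1 * p`_(i + k.+1).
exists (k + n)%N, n, (size p), b; split; first exact: leq_addl.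
  by exists d.+1, e.
move=> v; have := rel v.
rewrite -(big_mkord xpredT (fun i => p`_i *: iter (i + n) phi v)).
rewrite (big_cat_nat _ (n := k)) //=; last exact: ltnW.
rewrite big_nat big1 ?add0r; last by move=> i ik; rewrite mink ?scale0r.
rewrite big_ltn // => /eqP; rewrite addr_eq0 => /eqP relk.
apply: (scalerI pk); rewrite relk.
rewrite -iterS (iter_linear_sum (k + n).+1) scaler_sumr.
have term (i : nat) : p`_k *: iter (k + n).+1 phi
    (- (p`_k)^-1 * p`_(i + k.+1) *: iter i phi v) =
    - (p`_(i + k.+1) *: iter (i + k.+1 + n) phi v).
  rewrite iter_linearZ scalerA mulrA mulrN divff // mulN1r scaleNr -iterD.
  by rewrite -addSn [(k.+1 + n + i)%N]addnC addnA.
under [RHS]eq_bigr do rewrite term.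
rewrite sumrN; congr (- _).
rewrite -{1}[k.+1]add0n big_addn.
rewrite -[RHS](big_mkord xpredT (fun i => p`_(i + k.+1) *: iter (i + k.+1 + n) phi v)).
rewrite [RHS](big_cat_nat _ (n := size p - k.+1)) //=; last exact: leq_subr.
rewrite -[LHS]addr0; congr (_ + _).
rewrite big_nat big1 // => i /andP[ki _].
by rewrite nth_default ?scale0r // addnC -leq_subLR.
Qed.

Lemma is_index_exists phi : finite_potent phi -> exists n, is_index phi n.
Proof.
move=> /finite_potent_relation [m [n [d [b [nm fd rel]]]]].
pose psi v := \sum_i b i *: iter i phi v.
have phipsi i v : iter i phi (psi v) = psi (iter i phi v).
  rewrite /psi iter_linear_sum; apply: eq_bigr => j _.
  by rewrite iter_linearZ -!iterD addnC.
have relk k v : iter m phi v = iter (k + m) phi (iter k psi v).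
  elim: k v => // k IH v; rewrite IH.
  by rewrite iterD rel -/(psi _) -iterD addnS -addSn.
pose W := range (iter m phi); pose U := [set v | iter m phi v = 0].
have inj x : W x -> phi x = 0 -> x = 0.
  case=> v _ <- e; rewrite rel -/(psi _) phipsi iterS e /psi.
  by apply: big1 => i _; rewrite iter_linear0 scaler0.
have injk k x : W x -> iter k phi x = 0 -> x = 0.
  elim: k x => // k IH x Wx; rewrite iterSr => /IH; move/(_ _)/inj; apply=> //.
  by case: Wx => v _ <-; exists (phi v) => //; rewrite -iterSr.
have ast : ast_decomposition phi W U.
  split.
  - split=> [|a u v /set_mem[x _ <-] /set_mem[y _ <-]]; apply/mem_set.
      by exists 0 => //; exact: iter_linear0.
    by exists (a *: x + y) => //; exact: iter_is_linear.
  - split=> [|a u v /set_mem/= Uu /set_mem/= Uv]; apply/mem_set => /=.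
      exact: iter_linear0.
    by rewrite /U /= iter_is_linear Uu Uv scaler0 addr0.
  - split=> [v|].
      pose a := iter m phi (iter m psi v).
      exists a, (v - a); split; first by exists (iter m psi v).
        by rewrite /U /= iter_linearB /a -iterD -relk subrr.
      by rewrite addrC subrK.
    apply/seteqP; split=> [v [Wv Uv]|v ->] /=; first exact: (injk m).
    by split; [exists 0 => //|]; exact: iter_linear0.
  - by move=> _ [_ [v _ <-] <-]; exists (phi v) => //; rewrite -iterSr.
  - by move=> _ [v Uv <-]; rewrite /U /= -iterSr iterS Uv linear0.
  - by exists m.
  - have [d' [e im_n]] := fd.
    exists d', (fun i => iter (m - n) phi (e i)).
    have itE c : iter (m - n) phi (\sum_i c i *: e i) =
        \sum_(i < d') c i *: iter (m - n) phi (e i).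
      by rewrite iter_linear_sum; apply: eq_bigr => i _; rewrite iter_linearZ.
    have -> : W = range (iter (m - n + n) phi) by rewrite subnK.
    apply/seteqP; split=> [_ [v _ <-]|_ [c _ <-]].
      have: range (iter n phi) (iter n phi v) by exists v.
      by rewrite im_n => -[c _ Ec]; exists c => //; rewrite -itE Ec iterD.
    have: range (iter n phi) (\sum_i c i *: e i) by rewrite im_n; exists c.
    by case=> v _ ev; exists v => //; rewrite iterD ev itE.
  - split.
    + by move=> _ [v _ <-]; exists (phi v) => //; rewrite -iterSr.
    + move=> x y /set_mem Wx /set_mem Wy exy; apply/eqP; rewrite -subr_eq0.
      apply/eqP/inj; last by rewrite linearB exy subrr.
      case: Wx Wy => v _ <- [w _ <-]; exists (v - w) => //.
      exact: iter_linearB.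
    + move=> _ [v _ <-]; exists (iter m phi (psi v)); first by exists (psi v).
      by rewrite [RHS]rel.
have exn : exists i, `[< vanishes_on phi U i >] by exists m; apply/asboolP.
exists (ex_minn exn), W, U; split=> //.
case: ex_minnP => i /asboolP Ui mini; split=> // j Uj.
by apply: mini; apply/asboolP.
Qed.

Lemma fp_indexP phi n : finite_potent phi -> is_index phi n <-> fp_index phi = n.
Proof.
move=> /is_index_exists phiP.
have idx : is_index phi (fp_index phi) := xgetPex 0%N phiP.
by split=> [/(is_index_unique idx)|<-].
Qed.

End FinitePotent.

Section MoorePenrose.
Context {K : numFieldType} {theta : {rmorphism K -> K}} {V : lmodType K}.
Variable g : {dot V for theta}.
Implicit Types (S : set V) (phi psi : {linear V -> V}).

Definition orth S : set V := [set v | forall u, S u -> g u v = 0].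

Definition mp_admissible phi :=
  direct_sum (ker phi) (orth (ker phi)) /\
  direct_sum (range phi) (orth (range phi)).

(* Meaningful when [V] is the direct sum of the subspace [S] and [orth S], where
   the default value 0 of [xget] is not used: see [orth_projP]. *)
Definition orth_proj S (v : V) : V := xget 0 [set s | S s /\ orth S (v - s)].

Definition core_inverse phi psi :=
  (forall v, phi (psi v) = orth_proj (range phi) v) /\
  range psi `<=` range phi.

Lemma orth_projP S (v s : V) : submod_closed (mem S) ->
  direct_sum S (orth S) ->
  (S s /\ orth S (v - s)) <-> orth_proj S v = s.
Proof.
move=> [_ Slin] [dec disj].
have h : S (orth_proj S v) /\ orth S (v - orth_proj S v).
  apply: (@xgetPex V 0 [set s | S s /\ orth S (v - s)]).
  have [a [b [Sa Sb ->]]] := dec v.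
  by exists a; split=> //; rewrite addrC addKr.
split=> [[Ss Os]|<- //]; case: h; set t := orth_proj S v => St Ot.
apply/eqP; rewrite -subr_eq0; apply/eqP.
suff: (S `&` orth S) (t - s) by rewrite disj.
split.
  rewrite addrC -scaleN1r; apply/set_mem.
  by apply: Slin; apply/mem_set.
move=> u Su.
have -> : t - s = (v - s) - (v - t) by rewrite opprB [RHS]addrC addrA subrK.
by rewrite linearBr [X in X - _]Os // [X in _ - X]Ot // subrr.
Qed.

End MoorePenrose.

(* Main.v *)
Require Import Defs.
From mathcomp Require Import all_boot all_order all_algebra.
From mathcomp Require Import sesquilinear reals.
From mathcomp Require Import boolp classical_sets functions.

(** If psi is a core inverse of phi, then phi psi phi = phi because phi psi is a
    projection onto Im phi, and psi phi has values in Im phi; hence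
    Im phi = Im phi^2, so Im phi = Im phi^n for all n >= 1. In the
    AST-decomposition V = W + U, large powers of phi map into W, so phi U lies
    in the intersection of W and U, which is zero. *)

Set Implicit Arguments.
Unset Strict Implicit.
Unset Printing Implicit Defensive.

Import GRing.Theory.

Local Open Scope ring_scope.
Local Open Scope classical_set_scope.

Lemma submod_closed_range (K : fieldType) (V : lmodType K)
    (phi : {linear V -> V}) : submod_closed (mem (range phi)).
Proof.
split=> [|a u v /set_mem[x _ <-] /set_mem[y _ <-]]; apply/mem_set.
  by exists 0 => //; rewrite linear0.
by exists (a *: x + y) => //; rewrite linearP.
Qed.

(** The innermost [phi w] of an iterate can be replaced by some [phi (phi x)], which raises the
    exponent by one. *)
Lemma range_iterS (K : fieldType) (V : lmodType K) (phi : {linear V -> V}) n :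
  range phi `<=` range (iter 2 phi) -> range phi `<=` range (iter n.+1 phi).
Proof.
move=> sub; elim: n => [//|n IH] v /IH[w _ <-].
have /sub[x _ phix] : range phi (phi w) by exists w.
by exists x => //; rewrite iterSr iterSr -/(iter 2 phi x) phix -iterSr.
Qed.

Lemma fp_index_le1 (K : fieldType) (V : lmodType K) (phi : {linear V -> V}) :
  finite_potent phi -> range phi `<=` range (iter 2 phi) ->
  (fp_index phi <= 1)%N.
Proof.
move=> fp sub.
have [W [U [ast [_]]]] : is_index phi (fp_index phi) by apply/fp_indexP.
(* By minimality of the nilpotency order, it suffices that [phi] vanishes on [U]. *)
apply=> u Uu /=.
case: ast => sW sU [dec disj] stW stU [N nilU] _ _.
have /(range_iterS N sub)[w _ phiu] : range phi (phi u) by exists u.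
suff : (W `&` U) (phi u) by rewrite disj.
split; last by apply: stU; exists u.
have [a [b [Wa Ub wE]]] := dec w.
(* The [U]-component [b] of [w] is killed by [iter N phi], so [phi u] is an iterate of [a], which
   stays in [W]. *)
rewrite -phiu wE iter_linearD [X in _ + X]iterS nilU // linear0 addr0.
elim: N.+1 => //= n IH.
by apply: stW; exists (iter n phi a).
Qed.

Lemma core_inverseK (K : numFieldType) (theta : {rmorphism K -> K})
    (V : lmodType K) (g : {dot V for theta}) (phi psi : {linear V -> V}) v :
  mp_admissible g phi -> core_inverse g phi psi -> phi (psi (phi v)) = phi v.
Proof.
move=> [_ dimg] [-> _].
(* [phi v] is its own projection: it lies in the range and leaves residual 0. *)
apply/(orth_projP _ _ (submod_closed_range phi) dimg); split; first by exists v.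
by move=> u _; rewrite subrr linear0r.
Qed.

Theorem proposition4p2 (R : realType) (k : base_field)
    (V : lmodType (scalars R k)) (g : {dot V for conj_of R k})
    (phi : {linear V -> V}) :
  finite_potent phi -> mp_admissible g phi ->
  (exists psi : {linear V -> V}, core_inverse g phi psi) ->
  (fp_index phi <= 1)%N.
Proof.
move=> fp adm [psi core]; apply: fp_index_le1 => // _ [v _ <-].
have /core.2[w _ psiE] : range psi (psi (phi v)) by exists (phi v).
(* Here [phi (phi w) = phi (psi (phi v)) = phi v]. *)
by exists w => //=; rewrite psiE (core_inverseK _ adm core).
Qed.
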